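(* Assume that it is not true that every non-constant natural function $g\in\mathcal{F}_{Natural}$ satisfies $g(\mathbb{I})\not\subset\mathbb{P}$. Then there exists a natural function $f\in\mathcal{F}_{Natural}$ all of whose values are prime numbers and which takes arbitrarily large values; that is, $f(n)\in\mathbb{P}$ for all $n\in\mathbb{I}$, and for every $N\in\mathbb{I}$ there exists $n\in\mathbb{I}$ with $f(n)>N$.
   Context: Let $\mathbb{I}=\{1,2,3,\ldots\}$ be the set of non-zero positive integers, $\mathbb{P}$ the set of prime numbers, and $\mathcal{F}$ the set of all functions from $\mathbb{I}$ to $\mathbb{I}$. For $f,g\in\mathcal{F}$, the functions $f+g$, $f\times g$, $f\wedge g$ are defined pointwise, where $\wedge$ is exponentiation: $(f\wedge g)(n)=f(n)^{g(n)}$. Let $\mathcal{F}_s\subset\mathcal{F}$ be the set consisting of the identity map $n\mapsto n$ and all constant maps $n\mapsto a$ with $a\in\mathbb{I}$. For a subset $P\subset\mathcal{F}$ and an operation $*\in\{+,\times,\wedge\}$ put $A_*(P)=P\cup\{f\in\mathcal{F}\mid \exists g\in P,\ \exists h\in P,\ f=g*h\}$. Let $\Sigma$ be the set of all finite words in the letters $A_+,A_\times,A_\wedge$ (each word acting on subsets of $\mathcal{F}$ by composition). The set of natural functions is $\mathcal{F}_{Natural}=\bigcup_{\sigma\in\Sigma}\sigma(\mathcal{F}_s)$. *)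

(* Defs.v *)
From Stdlib Require Import PArith ZArith Znumtheory List Ensembles Image.

(** The set of non-zero positive integers {1, 2, 3, ...} is [positive]. *)
Definition arith_fun : Type := positive -> positive.

Definition prime_positive : Ensemble positive := fun p => prime (Zpos p).

Definition range (f : arith_fun) : Ensemble positive :=
  Im positive positive (Full_set positive) f.

Definition constant_fun (f : arith_fun) : Prop :=
  exists a : positive, f = (fun _ => a).

Definition starting_funs : Ensemble arith_fun :=
  fun f => f = (fun n => n) \/ constant_fun f.

Inductive operation : Set := Plus | Times | Wedge.

Definition apply_operation (o : operation) : positive -> positive -> positive :=
  match o with
  | Plus => Pos.add
  | Times => Pos.mul
  | Wedge => Pos.pow
  end.

Definition pointwise (o : operation) (g h : arith_fun) : arith_fun :=
  fun n => apply_operation o (g n) (h n).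

Definition adjoin (o : operation) (P : Ensemble arith_fun) :
    Ensemble arith_fun :=
  Union arith_fun P
    (fun f => exists g, In arith_fun P g /\
              exists h, In arith_fun P h /\ f = pointwise o g h).

(** A word [o1 :: ... :: ok :: nil] stands for the composite
    [adjoin o1 (... (adjoin ok P))]; the empty word is the identity. *)
Definition word_action (w : list operation) (P : Ensemble arith_fun) :
    Ensemble arith_fun :=
  fold_right adjoin P w.

Definition natural_funs : Ensemble arith_fun :=
  fun f => exists w : list operation,
    In arith_fun (word_action w starting_funs) f.

(* Main.v *)
Require Import Defs.
From Stdlib Require Import PArith ZArith Znumtheory List Ensembles Image.
From Stdlib Require Import Classical FunctionalExtensionality Lia.

(** Addition, multiplication and exponentiation on the positive integers are
    monotone in both arguments, and strictly so outside the degenerate powers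
    [1 ^ y].  Hence every natural function is either constant or strictly
    increasing, and a strictly increasing [f] satisfies [f n >= n]. *)

Definition strictly_increasing (f : arith_fun) : Prop :=
  forall m n : positive, (m < n)%positive -> (f m < f n)%positive.

(** Values start at 1 or above, and each unit step gains at least 1. *)
Lemma strictly_increasing_ge_id (f : arith_fun) (n : positive) :
  strictly_increasing f -> (n <= f n)%positive.
Proof.
  intros Hf.
  induction n as [|n IH] using Pos.peano_ind; [lia|].
  specialize (Hf n (Pos.succ n)). lia.
Qed.

Lemma Pos_pow_1_l (n : positive) : (1 ^ n)%positive = 1%positive.
Proof.
  induction n as [|n IH] using Pos.peano_ind; [reflexivity|].
  now rewrite Pos.pow_succ_r, IH.
Qed.

(** Exponents start at 1, so the strict inequality is never flattened by a zeroth power. *)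
Lemma Pos_pow_lt_mono_l (a b c : positive) :
  (a < b)%positive -> (a ^ c < b ^ c)%positive.
Proof.
  intros Hab. apply Pos2Z.pos_lt_pos in Hab.
  change (Zpos (a ^ c) < Zpos (b ^ c))%Z. rewrite !Pos2Z.inj_pow.
  apply Z.pow_lt_mono_l; lia.
Qed.

Lemma Pos_pow_lt_mono_r (a b c : positive) :
  (1 < a)%positive -> (b < c)%positive -> (a ^ b < a ^ c)%positive.
Proof.
  intros Ha Hbc. apply Pos2Z.pos_lt_pos in Ha, Hbc.
  change (Zpos (a ^ b) < Zpos (a ^ c))%Z. rewrite !Pos2Z.inj_pow.
  apply Z.pow_lt_mono_r; lia.
Qed.

Lemma Pos_pow_le_mono_r (a b c : positive) :
  (b <= c)%positive -> (a ^ b <= a ^ c)%positive.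
Proof.
  intros Hbc. apply Pos2Z.pos_le_pos in Hbc.
  change (Zpos (a ^ b) <= Zpos (a ^ c))%Z. rewrite !Pos2Z.inj_pow.
  apply Z.pow_le_mono_r; lia.
Qed.

Lemma pointwise_constant_or_increasing (o : operation) (g h : arith_fun) :
  constant_fun g \/ strictly_increasing g ->
  constant_fun h \/ strictly_increasing h ->
  constant_fun (pointwise o g h) \/ strictly_increasing (pointwise o g h).
Proof.
  intros [[a ->]|Hg] [[b ->]|Hh].
  - left. now exists (apply_operation o a b).
  - destruct o; unfold strictly_increasing, pointwise; simpl.
    + right. intros m n Hmn. specialize (Hh m n Hmn). lia.
    + right. intros m n Hmn. specialize (Hh m n Hmn). nia.
    (* Base 1 collapses the power to the constant 1; any other base is at least 2. *)
    + destruct (Pos.eq_dec a 1) as [->|Ha].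
      * left. exists 1%positive. extensionality n. apply Pos_pow_1_l.
      * right. intros m n Hmn. apply Pos_pow_lt_mono_r; [lia|auto].
  - right. intros m n Hmn. specialize (Hg m n Hmn).
    destruct o; unfold pointwise; simpl; [lia|nia|].
    now apply Pos_pow_lt_mono_l.
  - right. intros m n Hmn. specialize (Hg m n Hmn). specialize (Hh m n Hmn).
    destruct o; unfold pointwise; simpl; [lia|nia|].
    (* Raising the base first already gives strictness, so a weak inequality suffices for the
       exponent. *)
    apply Pos.lt_le_trans with (g n ^ h m)%positive.
    + now apply Pos_pow_lt_mono_l.
    + apply Pos_pow_le_mono_r. lia.
Qed.

Lemma natural_constant_or_increasing (f : arith_fun) :
  In arith_fun natural_funs f -> constant_fun f \/ strictly_increasing f.
Proof.
  (* [f] is generalized because a new function combines two others, [g] and [h], of the preceding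
     stage. *)
  intros [w Hw]. revert f Hw.
  induction w as [|o w IH]; simpl; intros f Hf.
  - destruct Hf as [->|Hf]; [right|now left].
    now intros m n Hmn.
  - destruct Hf as [f Hf|f (g & Hg & h & Hh & ->)]; [now apply IH|].
    apply pointwise_constant_or_increasing; now apply IH.
Qed.

Theorem proposition3p3 :
  ~ (forall g : arith_fun,
       In arith_fun natural_funs g -> ~ constant_fun g ->
       ~ Included positive (range g) prime_positive) ->
  exists f : arith_fun,
    In arith_fun natural_funs f /\
    (forall n : positive, In positive prime_positive (f n)) /\
    (forall N : positive, exists n : positive, (f n > N)%positive).
Proof.
  (* Classically, the failing universal statement yields a non-constant [g] with only prime values;
     this [g] is the witness. *)
  intros Hex. apply NNPP. intros Hno. apply Hex.
  intros g Hg Hnc Hprime. apply Hno. exists g.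
  split; [assumption|split].
  - intros n. apply Hprime. now exists n.
  (* The bound [n <= g n] is weak, so exceeding [N] takes the successor. *)
  - intros N. exists (Pos.succ N).
    destruct (natural_constant_or_increasing g Hg) as [Hc|Hi]; [contradiction|].
    pose proof (strictly_increasing_ge_id g (Pos.succ N) Hi). lia.
Qed.
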